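(* Let $n\ge2$ and let $\{x_1,\dots,x_n\}$ be a linearly independent system of vectors in $H$. Then $$\Gamma(x_1,\dots,x_n)\le\|x_1\|^2\prod_{k=2}^n\left(\|x_k\|^2-\frac{\sum_{i=1}^{k-1}|\langle x_k,x_i\rangle|^2}{\max_{1\le i\le k-1}\|x_i\|^2+(k-2)\max_{1\le i\ne j\le k-1}|\langle x_i,x_j\rangle|}\right)\le\prod_{j=1}^n\|x_j\|^2.$$
   Context: $(H;\langle\cdot,\cdot\rangle)$ is an inner product space over the real or complex number field, with norm $\|x\|=\langle x,x\rangle^{1/2}$. For vectors $y_1,\dots,y_m\in H$, $\Gamma(y_1,\dots,y_m)$ denotes the Gram determinant, i.e. the determinant of the $m\times m$ matrix whose $(i,j)$-entry is $\langle y_i,y_j\rangle$. For $k=2$ the term $(k-2)\max_{1\le i\ne j\le k-1}|\langle x_i,x_j\rangle|$ is read as $0$. *)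

(* Defs.v *)
From HB Require Import structures.
From mathcomp Require Import all_boot all_order all_algebra.
From mathcomp Require Import sesquilinear.
From mathcomp Require Import reals.
From mathcomp Require Import complex.

Set Implicit Arguments.
Unset Strict Implicit.
Unset Printing Implicit Defensive.

Import Order.TTheory GRing.Theory Num.Theory.

Local Open Scope ring_scope.

(* [vector.free] needs a finite-dimensional ambient space, hence this
   definition. *)
Definition lin_indep (K : fieldType) (H : lmodType K) (n : nat)
    (x : 'I_n -> H) : Prop :=
  forall c : 'I_n -> K, \sum_(i < n) c i *: x i = 0 -> forall i, c i = 0.

(* The norm induced by an inner product, with values in the scalar field. *)
Definition rnorm (R : realType) (H : lmodType R) (dot : {dot H for idfun})
    (u : H) : R :=
  Num.sqrt (dot u u).

Definition cnorm (R : realType) (H : lmodType R[i])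
    (dot : {dot H for Num.conj}) (u : H) : R[i] :=
  sqrtC (dot u u).

Section Gram.
Variables (K : numFieldType) (H : lmodType K).
Variables (dot : H -> H -> K) (norm : H -> K).
Variables (n : nat) (x : 'I_n -> H).

Definition gram_det : K := \det (\matrix_(i < n, j < n) dot (x i) (x j)).

(* Indices start at 0: [k : 'I_n] stands for the (k+1)-st vector, so the vectors
   before it are the [x i] with [i < k], and the coefficient (k + 1) - 2 is
   [k - 1].
   All the values compared by [Num.max] are real and nonnegative, so the
   default value 0 does not alter a maximum over a nonempty range, and these
   are genuine maxima also for K = R[i], which is only partially ordered. For
   k = 1 there is no pair of distinct indices below k, and the last term is 0. *)
Definition max_sqnorm (k : 'I_n) : K :=
  \big[Num.max/0]_(i < n | (i < k)%N) norm (x i) ^+ 2.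

Definition max_offdiag (k : 'I_n) : K :=
  \big[Num.max/0]_(p : 'I_n * 'I_n | [&& (p.1 < k)%N, (p.2 < k)%N & p.1 != p.2])
     `|dot (x p.1) (x p.2)|.

Definition gram_factor (k : 'I_n) : K :=
  norm (x k) ^+ 2
  - (\sum_(i < n | (i < k)%N) `|dot (x k) (x i)| ^+ 2)
    / (max_sqnorm k + (k - 1)%N%:R * max_offdiag k).

End Gram.

(* Main.v *)
Require Import Defs.
From HB Require Import structures.
From mathcomp Require Import all_boot all_order all_algebra.
From mathcomp Require Import ring.
From mathcomp Require Import sesquilinear.
From mathcomp Require Import reals.
From mathcomp Require Import complex.

Set Implicit Arguments.
Unset Strict Implicit.
Unset Printing Implicit Defensive.

Import Order.TTheory GRing.Theory Num.Theory.

Local Open Scope ring_scope.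

(* The Gram determinant is the product of the squared distances
   |w_k|^2 = |x_k|^2 - |p_k|^2 from x_k to the span of the previous vectors,
   p_k being the orthogonal projection of x_k on that span. A Bessel inequality
   for non-orthogonal vectors (Boas-Bellman-Bombieri), applied to p_k, gives
     |p_k|^2 >= \sum_(i < k) |<x_k, x_i>|^2 / (max |x_i|^2 + (k - 2) max |<x_i, x_j>|),
   because <p_k, x_i> = <x_k, x_i>. Hence each factor of the middle product lies
   between |w_k|^2 and |x_k|^2. *)

(** The order of [K] may be partial, as on the complex numbers; nonnegative values are real, hence
    comparable, so [Num.max] behaves as a true maximum. *)
Lemma bigmax0_ge (K : numFieldType) (I : finType) (P : pred I) (F : I -> K) :
  (forall i, 0 <= F i) ->
  0 <= \big[Num.max/0]_(i | P i) F i /\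
  (forall j, P j -> F j <= \big[Num.max/0]_(i | P i) F i).
Proof.
move=> F0; suff H r : 0 <= \big[Num.max/0]_(i <- r | P i) F i /\
    (forall j, j \in r -> P j -> F j <= \big[Num.max/0]_(i <- r | P i) F i).
  by have [? H2] := H (index_enum I); split=> // j; apply/H2/mem_index_enum.
elim: r => [|a r [IH0 IH]]; first by rewrite big_nil.
rewrite big_cons; case: ifP => Pa; last first.
  by split=> // j; rewrite inE => /predU1P[->|/IH //]; rewrite Pa.
have cmp : F a >=< \big[Num.max/0]_(i <- r | P i) F i.
  by apply: real_comparable; apply: ger0_real.
split=> [|j]; first by rewrite comparable_le_max // F0.
rewrite inE comparable_le_max // => /predU1P[-> _|/IH jr /jr ->].
  by rewrite lexx.
by rewrite orbT.
Qed.

(* Taking [theta] to be the identity or the conjugation covers the real and the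
   complex case at once. *)
Section InnerProduct.
Variables (K : numFieldType) (theta : {rmorphism K -> K}).
Hypothesis normK : forall a, `|a| ^+ 2 = a * theta a.
Variables (H : lmodType K) (dot : {dot H for theta}).

Lemma dotC u v : dot u v = theta (dot v u).
Proof. by rewrite hermC mul1r. Qed.

Lemma dotZl a u v : dot (a *: u) v = a * dot u v.
Proof. exact: linearZl_LR. Qed.

Lemma dotZr a u v : dot u (a *: v) = theta a * dot u v.
Proof. exact: linearZr_LR. Qed.

Lemma dot_ge0 u : 0 <= dot u u.
Proof.
by have [->|/neq0_dnorm_gt0/ltW//] := eqVneq u 0; rewrite linear0l.
Qed.

Lemma dot_eq0 u : (dot u u == 0) = (u == 0).
Proof.
have [->|u0] := eqVneq u 0; first by rewrite linear0l eqxx.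
exact/gt_eqF/neq0_dnorm_gt0.
Qed.

Lemma theta_ge0 a : 0 <= a -> theta a = a.
Proof.
move=> a0; have [->|an0] := eqVneq a 0; first exact: rmorph0.
by apply/(mulfI an0); rewrite -normK ger0_norm.
Qed.

Lemma norm_theta a : `|theta a| = `|a|.
Proof.
have [->|an0] := eqVneq a 0; first by rewrite rmorph0.
apply/(@mulfI _ `|a|); first by rewrite normr_eq0.
by rewrite -normrM -normK normrX normr_id expr2.
Qed.

Lemma dot_sum (I J : finType) (P : pred I) (Q : pred J) (c : I -> K) (d : J -> K)
    (x : I -> H) (y : J -> H) :
  dot (\sum_(i | P i) c i *: x i) (\sum_(j | Q j) d j *: y j)
  = \sum_(i | P i) \sum_(j | Q j) c i * theta (d j) * dot (x i) (y j).
Proof.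
rewrite linear_sumlz; apply: eq_bigr => i _.
rewrite linear_sumr; apply: eq_bigr => j _ /=.
by rewrite dotZl dotZr mulrA.
Qed.

Lemma dot_orthoD p w : dot w p = 0 -> dot (p + w) (p + w) = dot p p + dot w w.
Proof.
move=> wp; rewrite linearDl !linearDr /= wp add0r.
by rewrite (dotC p w) wp rmorph0 addr0.
Qed.

(** * Bombieri's inequality for a family that need not be orthogonal *)

Section Bombieri.
Variables (I : finType) (P : pred I) (y : I -> H) (M Q : K).
Hypotheses (M_ge0 : 0 <= M) (Q_ge0 : 0 <= Q).
Hypothesis leM : forall i, P i -> dot (y i) (y i) <= M.
Hypothesis leQ : forall i j, P i -> P j -> i != j -> `|dot (y i) (y j)| <= Q.

(** Expand the square and bound each [|c i| |c j|] by the mean of the two squares; by symmetry every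
    [|c i| ^+ 2] is then weighted by a row sum of the bounds on the Gram entries. *)
Lemma dot_comb_le (c : I -> K) :
  dot (\sum_(i | P i) c i *: y i) (\sum_(i | P i) c i *: y i) <=
    (M + (#|P| - 1)%N%:R * Q) * \sum_(i | P i) `|c i| ^+ 2.
Proof.
pose T (i j : I) := if i == j then M else Q.
have leT i j : P i -> P j -> `|dot (y i) (y j)| <= T i j.
  move=> Pi Pj; rewrite /T; have [<-|ij] := eqVneq i j; last exact: leQ.
  by rewrite ger0_norm ?dot_ge0 // leM.
have sumT i : P i -> \sum_(j | P j) T i j = M + (#|P| - 1)%N%:R * Q.
  move=> Pi; rewrite (bigD1 i) //= {1}/T eqxx; congr (_ + _).
  rewrite (eq_bigr (fun=> Q)) => [|j /andP[_ /negPf ji]]; last first.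
    by rewrite /T eq_sym ji.
  rewrite sumr_const mulr_natl; congr (_ *+ _).
  rewrite (cardD1 i P) [i \in P]Pi add1n subn1 /=.
  by apply: eq_card => j; rewrite !inE andbC.
rewrite -(ger0_norm (dot_ge0 _)) dot_sum.
have tle : `|\sum_(i | P i) \sum_(j | P j) c i * theta (c j) * dot (y i) (y j)|
    <= \sum_(i | P i) \sum_(j | P j) `|c i| * `|c j| * T i j.
  apply: le_trans (ler_norm_sum _ _ _) _; apply: ler_sum => i Pi.
  apply: le_trans (ler_norm_sum _ _ _) _; apply: ler_sum => j Pj.
  by rewrite !normrM norm_theta ler_wpM2l ?mulr_ge0 ?leT.
(* Both sides are doubled so that the mean inequality applies without halves. *)
apply: le_trans tle _; rewrite -(ler_pMn2r (n := 2)) // -sumrMnl.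
have -> : (M + (#|P| - 1)%N%:R * Q) * (\sum_(i | P i) `|c i| ^+ 2) *+ 2
    = \sum_(i | P i) \sum_(j | P j) (`|c i| ^+ 2 + `|c j| ^+ 2) * T i j.
  under [RHS]eq_bigr do under eq_bigr do rewrite mulrDl.
  under [RHS]eq_bigr do rewrite big_split.
  rewrite big_split /= [X in _ = _ + X]exchange_big /= mulr2n mulr_sumr.
  congr (_ + _); apply: eq_bigr => i Pi; rewrite -mulr_sumr.
    by rewrite sumT // mulrC.
  rewrite (eq_bigr (T i)) => [|j _]; first by rewrite sumT // mulrC.
  by rewrite /T eq_sym.
apply: ler_sum => i Pi; rewrite -sumrMnl; apply: ler_sum => j Pj.
rewrite -mulrnAl ler_wpM2r //; first by apply: le_trans (leT _ _ Pi Pj).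
by rewrite real_leif_mean_square_scaled ?normr_real.
Qed.

(** Cauchy-Schwarz for [u] and [z]: since [dot u z = S] and [dot z z <= D * S], it gives
    [S ^+ 2 <= dot u u * D * S], and a nonzero [S] cancels. *)
Lemma bombieri u :
  \sum_(i | P i) `|dot u (y i)| ^+ 2 <= dot u u * (M + (#|P| - 1)%N%:R * Q).
Proof.
set S := \sum_(i | P i) _; set D := M + _.
pose z := \sum_(i | P i) dot u (y i) *: y i.
have S0 : 0 <= S by apply: sumr_ge0 => i _; rewrite exprn_ge0.
have uz : dot u z = S.
  by rewrite linear_sumr; apply: eq_bigr => i _ /=; rewrite dotZr normK mulrC.
have zu : dot z u = S by rewrite dotC uz theta_ge0.
have zz : dot z z <= D * S by apply: dot_comb_le.
have [u0|un0] := eqVneq u 0.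
  rewrite /S big1 => [|i _]; first by rewrite u0 linear0l mul0r.
  by rewrite u0 linear0l normr0 expr0n.
have N_gt0 : 0 < dot u u by apply: neq0_dnorm_gt0.
have [->|Sn0] := eqVneq S 0.
  by rewrite mulr_ge0 ?dot_ge0 // addr_ge0 // mulr_ge0.
have S_gt0 : 0 < S by rewrite lt0r Sn0.
(* Expanding [|S u - |u|^2 z|^2 >= 0] yields [S^2 <= |u|^2 |z|^2]. *)
have := dot_ge0 (S *: u - dot u u *: z).
rewrite linearBl !linearBr /= !dotZl !dotZr uz zu !theta_ge0 ?dot_ge0 //.
set N := dot u u in N_gt0 *.
have -> : S * (S * N) - S * (N * S) - (N * (S * S) - N * (N * dot z z))
    = N * (N * dot z z - S ^+ 2) by ring.
rewrite pmulr_rge0 // subr_ge0 => /le_trans /(_ (ler_wpM2l (ltW N_gt0) zz)).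
by rewrite mulrA expr2 ler_pM2r.
Qed.

End Bombieri.

(** * Gram-Schmidt and the Gram determinant as a product of squared distances *)

Section Projection.
Variables (n : nat) (x : 'I_n -> H).

(* Gram-Schmidt step: the new vector [x a] is first made orthogonal to the
   others, giving [w]; then [u] is corrected along [w]. *)
Lemma orthogonal_projection (s : seq 'I_n) (u : H) :
  exists c : 'I_n -> K, (forall i, i \notin s -> c i = 0) /\
    (forall j, j \in s -> dot (u - \sum_i c i *: x i) (x j) = 0).
Proof.
elim: s u => [|a s IH] u.
  by exists (fun=> 0).
have [c [c0 cP]] := IH u; have [d [d0 dP]] := IH (x a).
set v := u - _ in cP; set w := x a - _ in dP.
have dot_comb t : (forall j, j \in s -> dot t (x j) = 0) ->
    dot t (\sum_i d i *: x i) = 0.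
  move=> tP; rewrite linear_sumr big1 // => i _ /=; rewrite dotZr.
  have [/tP->|/d0->] := boolP (i \in s); first by rewrite mulr0.
  by rewrite rmorph0 mul0r.
have xaE : x a = \sum_i d i *: x i + w by rewrite addrC subrK.
(* If [x a] depends on the vectors indexed by [s], then [w] is 0 and so is [b]. *)
pose b := dot v w / dot w w.
(* These coefficients come from expanding [v - b *: w] in the [x i]. *)
exists (fun i => c i + b * ((i == a)%:R - d i)); split=> [i|j].
  rewrite inE negb_or => /andP[/negPf-> ias].
  by rewrite c0 // d0 // subrr mulr0 addr0.
have -> : u - \sum_i (c i + b * ((i == a)%:R - d i)) *: x i = v - b *: w.
  rewrite /v -addrA -opprD; congr (_ - _).
  under eq_bigr do rewrite scalerDl -scalerA scalerBl.
  rewrite big_split /= -scaler_sumr sumrB; congr (_ + _ *: (_ - _)).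
  rewrite (bigD1 a) //= eqxx scale1r big1 ?addr0 // => i /negPf->.
  by rewrite scale0r.
have ortho t j' : j' \in s -> t = v - b *: w -> dot t (x j') = 0.
  by move=> js ->; rewrite linearBl /= dotZl cP // dP // mulr0 subrr.
rewrite inE => /predU1P[->|js]; last exact: ortho js _.
rewrite [in x a]xaE linearDr /= dot_comb => [|i si]; last exact: ortho si _.
rewrite add0r linearBl /= dotZl /b.
have [w0|wn0] := eqVneq w 0; first by rewrite w0 !linear0r mulr0 subrr.
by rewrite divfK ?subrr // dot_eq0.
Qed.

(** Each [x k] is projected on the span of its predecessors, so the coefficients form a strictly
    lower triangular matrix. *)
Lemma gram_schmidt :
  exists c : 'I_n -> 'I_n -> K, (forall k i : 'I_n, (k <= i)%N -> c k i = 0) /\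
    (forall k j : 'I_n, (j < k)%N -> dot (x k - \sum_i c k i *: x i) (x j) = 0).
Proof.
have /fin_all_exists[c cP] (k : 'I_n) :=
  orthogonal_projection [seq i : 'I_n <- enum 'I_n | (i < k)%N] (x k).
exists c; split=> k i ki.
  by case: (cP k) => + _; apply; rewrite mem_filter mem_enum ltnNge ki.
by case: (cP k) => _; apply; rewrite mem_filter mem_enum andbT.
Qed.

(** The unitriangular matrix [L] turns the [x i] into the residuals [w k]. Hence [L], the Gram
    matrix and the conjugate transpose of [L] multiply to the Gram matrix of the [w k], which is
    diagonal, while [L] has determinant 1. *)
Lemma gram_det_ortho (c : 'I_n -> 'I_n -> K) :
  (forall k i : 'I_n, (k <= i)%N -> c k i = 0) ->
  (forall k j : 'I_n, (j < k)%N -> dot (x k - \sum_i c k i *: x i) (x j) = 0) ->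
  gram_det dot x =
    \prod_k dot (x k - \sum_i c k i *: x i) (x k - \sum_i c k i *: x i).
Proof.
move=> c0 cP; set w := fun k => x k - \sum_i c k i *: x i.
pose L := \matrix_(k < n, j < n) ((k == j)%:R - c k j).
have wE k : w k = \sum_j L k j *: x j.
  under eq_bigr do rewrite mxE scalerBl.
  rewrite sumrB (bigD1 k) //= eqxx scale1r big1 ?addr0 // => i.
  by rewrite eq_sym => /negPf->; rewrite scale0r.
have Lk (k i : 'I_n) : (k < i)%N -> L k i = 0.
  move=> ki; rewrite mxE c0 ?(ltnW ki) // subr0.
  by have [ki'|//] := eqVneq k i; rewrite ki' ltnn in ki.
have detL : \det L = 1.
  rewrite det_trig; last by apply/is_trig_mxP.
  by rewrite big1 // => k _; rewrite mxE eqxx c0 // subr0.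
(* [w l] only involves the [x j] with [j <= l < k], all orthogonal to [w k]. *)
have w_lt (k l : 'I_n) : (l < k)%N -> dot (w k) (w l) = 0.
  move=> lk; rewrite [w l]wE linear_sumr big1 // => j _ /=; rewrite dotZr.
  have [jl|/Lk->] := leqP j l; last by rewrite rmorph0 mul0r.
  by rewrite cP ?mulr0 //; apply: leq_ltn_trans lk.
set G := \matrix_(i < n, j < n) dot (x i) (x j).
have GE : L *m G *m map_mx theta L^T = diag_mx (\row_k dot (w k) (w k)).
  apply/matrixP => k l; have -> : (L *m G *m map_mx theta L^T) k l = dot (w k) (w l).
    rewrite !wE dot_sum mxE exchange_big; apply: eq_bigr => j _ /=.
    rewrite !mxE mulr_suml; apply: eq_bigr => i _.
    by rewrite [G i j]mxE mulrAC.
  rewrite !mxE; have [->//|] := eqVneq k l; rewrite mulr0n -val_eqE.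
  case: ltngtP => // [kl|/w_lt//] _.
  by rewrite dotC w_lt ?rmorph0.
have := congr1 determinant GE.
rewrite !det_mulmx det_map_mx det_tr detL rmorph1 mul1r mulr1 det_diag.
rewrite /gram_det -/G => ->.
by apply: eq_bigr => k _; rewrite mxE.
Qed.

End Projection.

(** * Bounds on each factor, then on the product *)

Lemma gram_factor_bounds (norm : H -> K) (n : nat) (x : 'I_n -> H)
    (c : 'I_n -> K) (k : 'I_n) :
  (forall u, norm u ^+ 2 = dot u u) ->
  (forall i : 'I_n, (k <= i)%N -> c i = 0) ->
  (forall j : 'I_n, (j < k)%N -> dot (x k - \sum_i c i *: x i) (x j) = 0) ->
  dot (x k - \sum_i c i *: x i) (x k - \sum_i c i *: x i)
    <= gram_factor dot norm x k <= norm (x k) ^+ 2.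
Proof.
move=> normE c0 cP; rewrite /gram_factor.
have norm_ge0 i : 0 <= norm (x i) ^+ 2 by rewrite normE dot_ge0.
have [M0 leM] := @bigmax0_ge K _ (fun i : 'I_n => (i < k)%N)
  (fun i => norm (x i) ^+ 2) norm_ge0.

rewrite -/(max_sqnorm norm x k) in M0 leM.
have [Q0 leQ] := @bigmax0_ge K _
  (fun p : 'I_n * 'I_n => [&& (p.1 < k)%N, (p.2 < k)%N & p.1 != p.2])
  (fun p => `|dot (x p.1) (x p.2)|) (fun=> normr_ge0 _).
rewrite -/(max_offdiag dot x k) in Q0 leQ.
set p := \sum_i _ in cP *; set w := x k - p in cP *.
have wp : dot w p = 0.
  rewrite linear_sumr big1 // => i _ /=; rewrite dotZr.
  have [/c0->|/cP->] := leqP k i; first by rewrite rmorph0 mul0r.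
  by rewrite mulr0.
have xkE : x k = p + w by rewrite addrC subrK.
have px (i : 'I_n) : (i < k)%N -> dot (x k) (x i) = dot p (x i).
  by move=> ik; rewrite xkE linearDl /= cP // addr0.
set S := \sum_(i < n | _) _; set D := _ + _ * _.
have S0 : 0 <= S by apply: sumr_ge0 => i _; rewrite exprn_ge0.
have D0 : 0 <= D by rewrite addr_ge0 // mulr_ge0.
(* With indices from 0 there are [k] predecessors, so the coefficient [#|P| - 1] of [bombieri] is
   the [k - 1] of [gram_factor]. *)
have card_lt : #|[pred i : 'I_n | (i < k)%N]| = k.
  by rewrite -sum1_card (big_ord_narrow (ltnW (ltn_ord k))) sum1_card card_ord.
have SD : S / D <= dot p p.
  (* [D] vanishes for instance at [k = 0], where both maxima are empty; the quotient is then 0 by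
     convention. *)
  have [->|Dn0] := eqVneq D 0; first by rewrite invr0 mulr0 dot_ge0.
  rewrite ler_pdivrMr ?lt0r ?Dn0 // /S.
  under eq_bigr => i ik do rewrite px //.
  have := @bombieri _ (fun i : 'I_n => (i < k)%N) x (max_sqnorm norm x k)
    (max_offdiag dot x k) M0 Q0 _ _ p.
  rewrite card_lt; apply=> [i ik|i j ik jk ij]; first by rewrite -normE leM.
  by apply: (leQ (i, j)); rewrite /= ik jk.
(* The upper bound is the nonnegativity of [S / D]; by Pythagoras the lower one reduces to [SD]. *)
rewrite normE gerBl divr_ge0 // andbT lerBrDr.
have -> : dot (x k) (x k) = dot p p + dot w w by rewrite {1 2}xkE dot_orthoD.
by rewrite addrC lerD2r.
Qed.

Lemma gram_det_bounds (norm : H -> K) (n : nat) (x : 'I_n -> H) (i0 : 'I_n) :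
  (forall u, norm u ^+ 2 = dot u u) -> i0 = 0%N :> nat ->
  gram_det dot x
    <= norm (x i0) ^+ 2 * \prod_(k < n | (0 < k)%N) gram_factor dot norm x k
    <= \prod_(j < n) norm (x j) ^+ 2.
Proof.
move=> normE i0E; have [c [c0 cP]] := gram_schmidt x.
rewrite (gram_det_ortho c0 cP).
have bnd k := gram_factor_bounds normE (c0 k) (cP k).
(* At index 0 the subtracted sum is empty, so the leading square is itself a factor. *)
have -> : norm (x i0) ^+ 2 * \prod_(k < n | (0 < k)%N) gram_factor dot norm x k
    = \prod_k gram_factor dot norm x k.
  rewrite [RHS](bigD1 i0) //=; congr (_ * _).
    by rewrite /gram_factor big1 ?mul0r ?subr0 // => i; rewrite i0E.
  by apply: eq_bigl => k; rewrite lt0n -val_eqE /= i0E.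
(* Comparing products termwise requires nonnegative smaller terms; the middle factors inherit this
   from the squared residuals below them. *)
apply/andP; split; apply: ler_prod => k _; have /andP[wk kx] := bnd k.
  by rewrite dot_ge0.
by rewrite (le_trans _ wk) ?dot_ge0.
Qed.

End InnerProduct.

Theorem mainTheorem8 (R : realType) (n : nat) (hn : (2 <= n)%N) :
  (forall (H : lmodType R) (dot : {dot H for idfun}) (x : 'I_n -> H),
     lin_indep x ->
     gram_det dot x
       <= rnorm dot (x (Ordinal (ltnW hn))) ^+ 2
          * \prod_(k < n | (0 < k)%N) gram_factor dot (rnorm dot) x k
       <= \prod_(j < n) rnorm dot (x j) ^+ 2)
  /\
  (forall (H : lmodType R[i]) (dot : {dot H for Num.conj}) (x : 'I_n -> H),
     lin_indep x ->
     gram_det dot x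
       <= cnorm dot (x (Ordinal (ltnW hn))) ^+ 2
          * \prod_(k < n | (0 < k)%N) gram_factor dot (cnorm dot) x k
       <= \prod_(j < n) cnorm dot (x j) ^+ 2).
Proof.
split=> H dot x _.
  apply: (@gram_det_bounds R idfun) => // [a|u].
    by rewrite real_normK ?num_real.
  by rewrite sqr_sqrtr //; apply: (@dot_ge0 R idfun).
apply: (@gram_det_bounds R[i] Num.conj) => // [a|u]; first exact: normCK.
by rewrite sqrtCK.
Qed.
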